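(* Let $\mathbf{G}$ be a finite RDF graph, let $\mathbf{S} = (\mathbf{L}, \mathbf{def})$ be a shapes schema with finitely many labels, and let $\mathit{strat}$ be a stratification of $\mathbf{S}$ with $k$ strata. Then the algorithm $\mathit{refine}(\mathbf{G}, \mathbf{S}, \mathit{strat})$ computes $\mathit{Typing}(\mathbf{G}, \mathbf{S}, \mathit{strat})$, i.e. it terminates and returns this typing. Moreover, for every $1 \le i \le k$, the $i$-th iteration of its main loop computes $\mathit{typing}_i$, i.e. the value of the variable $\mathit{typing}$ at the end of that iteration is $\mathit{typing}_i$.
   Context: **RDF graphs.** Let $\mathsf{IRI}$, $\mathsf{Lit}$, $\mathsf{Blank}$ be three pairwise disjoint sets (IRIs, literals, blank nodes). An RDF graph $\mathbf{G}$ is a set of triples $(s,p,o) \in (\mathsf{IRI} \cup \mathsf{Blank}) \times \mathsf{IRI} \times (\mathsf{IRI} \cup \mathsf{Lit} \cup \mathsf{Blank})$. $\mathrm{Nodes}(\mathbf{G})$ is the set of elements occurring as subject ($s$) or object ($o$) of some triple of $\mathbf{G}$. The neighbourhood of a node $n$ is $\mathit{neigh}(n) = \{(s,p,o) \in \mathbf{G} \mid s = n\}$. $N = N_1 \uplus N_2$ means $N = N_1 \cup N_2$ and $N_1 \cap N_2 = \emptyset$ (similarly for $k$ pairwise disjoint sets). **Shapes schemas.** A shapes schema is a pair $\mathbf{S} = (\mathbf{L}, \mathbf{def})$, where $\mathbf{L}$ is a set of shape labels and $\mathbf{def}$ maps every label of $\mathbf{L}$ to a shape expression. Let $\_b$ be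 a special constant. Shape expressions are given by $S ::= V \mid E \mid S \;\mathsf{AND}\; S \mid S \;\mathsf{OR}\; S \mid \mathsf{NOT}\; S$, where $V$ (a value description) is a subset of $\mathsf{IRI} \cup \mathsf{Lit} \cup \{\_b\}$ and $E$ (a neighbourhood description) is a triple expression. Triple expressions are given by $E ::= P\,@L \mid \mathsf{EMPTY} \mid (E \mid E) \mid E\,;E \mid E[\mathit{min};\mathit{max}]$, where $P \subseteq \mathsf{IRI}$, $L \in \mathbf{L}$, $\mathit{min}$ is a natural number and $\mathit{max}$ is a natural number or $*$ (unbounded). Membership in the sets $V$ and $P$ is assumed to be decidable. Standing assumption: all shape expressions $\mathbf{def}(L)$ are in disjunctive normal form; in particular $\mathsf{NOT}$ is applied only to atomic sub-expressions (value descriptions or triple expressions). **Typings and satisfaction.** A typing of $\mathbf{G}$ by $\mathbf{S}$ is a subset of $\mathrm{Nodes}(\mathbf{G}) \times \mathbf{L}$. For a typing $t$ and a set of triples $N$, the relation $t, N \vDash E$ is defined recursively on $E$: - $t, N \vDash P@L$ iff $N = \{(s,p,o)\}$ is a singleton with $p \in P$ and $(o,L) \in t$; - $t, N \vDash \mathsf{EMPTY}$ iff $N = \emptyset$; - $t, N \vDash E_1 \mid E_2$ iff $t,N \vDash E_1$ or $t,N \vDash E_2$; - $t, N \vDash E_1 ; E_2$ iff $N = N_1 \uplus N_2$ for some $N_1, N_2$ with $t,N_1 \vDash E_1$ and $t,N_2 \vDash E_2$; - $t, N \vDash E[\mathit{min};\mathit{max}]$ iff for some natural $k$ with $\mathit{min}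 \le k \le \mathit{max}$ (no upper bound if $\mathit{max} = *$), $N = N_1 \uplus \dots \uplus N_k$ with $t, N_j \vDash E$ for all $1 \le j \le k$ ($k=0$ being possible only when $N = \emptyset$). For a node $n$, the relation $t, n \vdash S$ is defined recursively on $S$: - $t, n \vdash V$ iff $n \in V$, or $n \in \mathsf{Blank}$ and $\_b \in V$; - $t, n \vdash E$ iff $t, \mathit{neigh}(n) \vDash E$; - $\mathsf{AND}$ and $\mathsf{OR}$ are interpreted as conjunction and disjunction; - $t, n \vdash \mathsf{NOT}\,S$ iff not $t, n \vdash S$. A typing $t$ is a *correct typing* of $\mathbf{G}$ by $\mathbf{S}$ if $t, n \vdash \mathbf{def}(L)$ for every $(n,L) \in t$. **Stratification.** For labels $L_1, L_2$: $\mathit{dep}^-(L_1,L_2)$ holds iff $L_2$ appears in $\mathbf{def}(L_1)$ under an occurrence of $\mathsf{NOT}$; $\mathit{dep}^+(L_1,L_2)$ holds iff $L_2$ appears in $\mathbf{def}(L_1)$ but never under an occurrence of $\mathsf{NOT}$. A stratification of $\mathbf{S}$ with $k$ strata ($k \ge 1$) is a map $\mathit{strat} : \mathbf{L} \to [1;k]$ such that $\mathit{dep}^-(L_1,L_2)$ implies $\mathit{strat}(L_1) > \mathit{strat}(L_2)$, and $\mathit{dep}^+(L_1,L_2)$ implies $\mathit{strat}(L_1) \ge \mathit{strat}(L_2)$. **Stratification-maximal typing.** For $1 \le i \le k$ let $\mathbf{L}_i = \{L \in \mathbf{L} \mid \mathit{strat}(L) \le i\}$ and let $\mathbf{S}_i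 = (\mathbf{L}_i, \mathbf{def}_i)$ with $\mathbf{def}_i$ the restriction of $\mathbf{def}$ to $\mathbf{L}_i$. For a typing $t$, let $t_{|\mathbf{L}_i} = \{(n,L) \in t \mid L \in \mathbf{L}_i\}$. Define $\mathit{typing}_1$ as the maximal correct typing of $\mathbf{G}$ by $\mathbf{S}_1$, i.e. the union of all correct typings of $\mathbf{G}$ by $\mathbf{S}_1$; and for $1 \le i < k$, $\mathit{typing}_{i+1}$ as the union of all correct typings $t'$ of $\mathbf{G}$ by $\mathbf{S}_{i+1}$ such that $t'_{|\mathbf{L}_i} = \mathit{typing}_i$. Then $\mathit{Typing}(\mathbf{G},\mathbf{S},\mathit{strat}) = \mathit{typing}_k$. **The algorithm $\mathit{refine}(\mathbf{G},\mathbf{S},\mathit{strat})$.** Start with the variable $\mathit{typing} := \emptyset$. Main loop: for $i = 1, \dots, k$ do 1. add to $\mathit{typing}$ all pairs $(n,L)$ with $n \in \mathrm{Nodes}(\mathbf{G})$ and $\mathit{strat}(L) = i$; 2. repeat the following pass until a pass removes nothing: for each $(n,L)$ in $\mathit{typing}$ with $\mathit{strat}(L) = i$ (in any order), if $\mathit{typing}, n \vdash \mathbf{def}(L)$ does not hold (for the current value of $\mathit{typing}$), remove $(n,L)$ from $\mathit{typing}$. Finally return $\mathit{typing}$. *)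

(* Defs.v *)
From mathcomp Require Import all_boot all_classical.
From Stdlib Require Import Relation_Operators.

Set Implicit Arguments.
Unset Strict Implicit.
Unset Printing Implicit Defensive.

Local Open Scope classical_set_scope.

Section Rdf.
Variables IRI Lit Blank : Type.

(* The three sets are pairwise disjoint because they are distinct summands. *)
Inductive term : Type :=
| TIri of IRI
| TLit of Lit
| TBlank of Blank.

Inductive subject : Type :=
| SIri of IRI
| SBlank of Blank.

Definition term_of_subject (s : subject) : term :=
  match s with
  | SIri i => TIri i
  | SBlank b => TBlank b
  end.

Definition triple : Type := (subject * IRI * term)%type.

Definition triple_subj (x : triple) : term := term_of_subject x.1.1.
Definition triple_obj (x : triple) : term := x.2.

Definition Nodes (G : set triple) : set term :=
  [set n | exists2 x, G x & n = triple_subj x \/ n = triple_obj x].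

Definition neigh (G : set triple) (n : term) : set triple :=
  [set x | G x /\ triple_subj x = n].

End Rdf.

Arguments TIri {IRI Lit Blank} _.
Arguments TLit {IRI Lit Blank} _.
Arguments TBlank {IRI Lit Blank} _.
Arguments SIri {IRI Blank} _.
Arguments SBlank {IRI Blank} _.

(* The set over which value descriptions range: IRIs, literals and the special
   constant [_b], here [VB]. *)
Inductive value (IRI Lit : Type) : Type :=
| VIri of IRI
| VLit of Lit
| VB.

Arguments VIri {IRI Lit} _.
Arguments VLit {IRI Lit} _.
Arguments VB {IRI Lit}.

(* Membership in the sets of predicates and in the value descriptions is
   decidable, hence the boolean predicates here and in [SValue].
   An upper bound [None] in [Repeat] stands for [*]. *)
Inductive texpr (IRI Lab : Type) : Type :=
| Arc of pred IRI & Lab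
| Empty
| Choice of texpr IRI Lab & texpr IRI Lab
| Group of texpr IRI Lab & texpr IRI Lab
| Repeat of texpr IRI Lab & nat & option nat.

Arguments Arc {IRI Lab} _ _.
Arguments Empty {IRI Lab}.
Arguments Choice {IRI Lab} _ _.
Arguments Group {IRI Lab} _ _.
Arguments Repeat {IRI Lab} _ _ _.

Inductive sexpr (IRI Lit Lab : Type) : Type :=
| SValue of pred (value IRI Lit)
| SNeigh of texpr IRI Lab
| SAnd of sexpr IRI Lit Lab & sexpr IRI Lit Lab
| SOr of sexpr IRI Lit Lab & sexpr IRI Lit Lab
| SNot of sexpr IRI Lit Lab.

Arguments SValue {IRI Lit Lab} _.
Arguments SNeigh {IRI Lit Lab} _.
Arguments SAnd {IRI Lit Lab} _ _.
Arguments SOr {IRI Lit Lab} _ _.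
Arguments SNot {IRI Lit Lab} _.

Section Syntax.
Variables IRI Lit Lab : Type.
Implicit Types (E : texpr IRI Lab) (S : sexpr IRI Lit Lab).

Fixpoint in_texpr (L : Lab) E : Prop :=
  match E with
  | Arc _ L' => L = L'
  | Empty => False
  | Choice E1 E2 | Group E1 E2 => in_texpr L E1 \/ in_texpr L E2
  | Repeat E1 _ _ => in_texpr L E1
  end.

Fixpoint in_sexpr (L : Lab) S : Prop :=
  match S with
  | SValue _ => False
  | SNeigh E => in_texpr L E
  | SAnd S1 S2 | SOr S1 S2 => in_sexpr L S1 \/ in_sexpr L S2
  | SNot S1 => in_sexpr L S1
  end.

Fixpoint under_not (L : Lab) S : Prop :=
  match S with
  | SValue _ | SNeigh _ => False
  | SAnd S1 S2 | SOr S1 S2 => under_not L S1 \/ under_not L S2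
  | SNot S1 => in_sexpr L S1
  end.

Definition is_atom S : Prop :=
  match S with
  | SValue _ | SNeigh _ => True
  | _ => False
  end.

Definition is_literal S : Prop :=
  match S with
  | SNot S1 => is_atom S1
  | _ => is_atom S
  end.

Fixpoint is_conj S : Prop :=
  match S with
  | SAnd S1 S2 => is_conj S1 /\ is_conj S2
  | _ => is_literal S
  end.

Fixpoint is_dnf S : Prop :=
  match S with
  | SOr S1 S2 => is_dnf S1 /\ is_dnf S2
  | _ => is_conj S
  end.

End Syntax.

(* The labels of a schema form a set [labels] in a type [Lab] of potential
   labels; the values of [def] outside [labels] are irrelevant. *)
Record schema (IRI Lit Lab : Type) : Type := Schema {
  labels : set Lab;
  def : Lab -> sexpr IRI Lit Lab
}.

Section Schemas.
Variables IRI Lit Lab : Type.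
Implicit Types (S : schema IRI Lit Lab) (strat : Lab -> nat).

(* Triple expressions of a schema only mention labels of this schema. *)
Definition wf_schema S : Prop :=
  forall L, labels S L -> forall L', in_sexpr L' (def S L) -> labels S L'.

Definition dnf_schema S : Prop :=
  forall L, labels S L -> is_dnf (def S L).

Definition dep_neg S (L1 L2 : Lab) : Prop :=
  [/\ labels S L1, labels S L2 & under_not L2 (def S L1)].

Definition dep_pos S (L1 L2 : Lab) : Prop :=
  [/\ labels S L1, labels S L2, in_sexpr L2 (def S L1)
    & ~ under_not L2 (def S L1)].

Definition stratification S (k : nat) strat : Prop :=
  [/\ 1 <= k,
      forall L, labels S L -> 1 <= strat L <= k,
      forall L1 L2, dep_neg S L1 L2 -> strat L1 > strat L2
    & forall L1 L2, dep_pos S L1 L2 -> strat L1 >= strat L2].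

Definition labels_upto S strat (i : nat) : set Lab :=
  [set L | labels S L /\ strat L <= i].

Definition schema_upto S strat (i : nat) : schema IRI Lit Lab :=
  Schema (labels_upto S strat i) (def S).

End Schemas.

Section Semantics.
Variables IRI Lit Blank Lab : Type.

Local Notation node := (term IRI Lit Blank).
Local Notation triple := (triple IRI Lit Blank).
Local Notation schema := (schema IRI Lit Lab).

Implicit Types (G N : set triple) (t todo : set (node * Lab)) (S : schema).

Definition le_max (k : nat) (max : option nat) : Prop :=
  if max is Some m then (k <= m)%N : Prop else True.

Fixpoint sat_texpr t N (E : texpr IRI Lab) : Prop :=
  match E with
  | Arc P L => exists s p o, [/\ N = [set (s, p, o)], P p & t (o, L)]
  | Empty => N = set0
  | Choice E1 E2 => sat_texpr t N E1 \/ sat_texpr t N E2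
  | Group E1 E2 => exists N1 N2,
      [/\ N = N1 `|` N2, N1 `&` N2 = set0, sat_texpr t N1 E1
        & sat_texpr t N2 E2]
  | Repeat E1 min max => exists (k : nat) (F : 'I_k -> set triple),
      [/\ min <= k, le_max k max, N = \bigcup_j F j, trivIset setT F
        & forall j, sat_texpr t (F j) E1]
  end.

Definition sat_value (n : node) (V : pred (value IRI Lit)) : Prop :=
  match n with
  | TIri i => V (VIri i)
  | TLit l => V (VLit l)
  | TBlank _ => V VB
  end.

Fixpoint sat_sexpr G t (n : node) (S : sexpr IRI Lit Lab) : Prop :=
  match S with
  | SValue V => sat_value n V
  | SNeigh E => sat_texpr t (neigh G n) E
  | SAnd S1 S2 => sat_sexpr G t n S1 /\ sat_sexpr G t n S2
  | SOr S1 S2 => sat_sexpr G t n S1 \/ sat_sexpr G t n S2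
  | SNot S1 => ~ sat_sexpr G t n S1
  end.

Definition is_typing G S t : Prop := t `<=` Nodes G `*` labels S.

Definition correct_typing G S t : Prop :=
  is_typing G S t /\ forall n L, t (n, L) -> sat_sexpr G t n (def S L).

Definition restrict_typing t (Ls : set Lab) : set (node * Lab) :=
  [set x | t x /\ Ls x.2].

(* [strata_typing G S strat i] is typing_i; the index starts at 1 and the value
   at 0 is a dummy. *)
Fixpoint strata_typing G S (strat : Lab -> nat) (i : nat) :
    set (node * Lab) :=
  match i with
  | 0 => set0
  | j.+1 =>
    if j is 0 then
      \bigcup_(t in [set t | correct_typing G (schema_upto S strat 1) t]) t
    else
      \bigcup_(t in [set t | correct_typing G (schema_upto S strat j.+1) t /\
           restrict_typing t (labels_upto S strat j)
           = strata_typing G S strat j]) t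
  end.

Definition Typing G S (k : nat) (strat : Lab -> nat) : set (node * Lab) :=
  strata_typing G S strat k.

(* Control states of the algorithm; [t] is the current value of the variable
   [typing] and [i] that of the loop counter. In [InPass i t todo removed],
   [todo] contains the pairs which the current pass has not visited yet, and
   [removed] tells whether this pass has already removed a pair. *)
Inductive state : Type :=
| LoopHead (i : nat) (t : set (node * Lab))
| PassStart (i : nat) (t : set (node * Lab))
| InPass (i : nat) (t todo : set (node * Lab)) (removed : bool)
| IterEnd (i : nat) (t : set (node * Lab))
| Return (t : set (node * Lab)).

(* Nondeterminism only comes from the order in which a pass visits pairs. *)
Inductive step G S (k : nat) (strat : Lab -> nat) : state -> state -> Prop :=
| StepEnter i t : i <= k ->
    step G S k strat (LoopHead i t)
      (PassStart i
         (t `|` [set x | [/\ Nodes G x.1, labels S x.2 & strat x.2 = i]]))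
| StepExit i t : k < i ->
    step G S k strat (LoopHead i t) (Return t)
| StepPass i t :
    step G S k strat (PassStart i t)
      (InPass i t [set x | t x /\ strat x.2 = i] false)
| StepKeep i t todo r n L : todo (n, L) -> sat_sexpr G t n (def S L) ->
    step G S k strat (InPass i t todo r) (InPass i t (todo `\ (n, L)) r)
| StepRemove i t todo r n L : todo (n, L) -> ~ sat_sexpr G t n (def S L) ->
    step G S k strat (InPass i t todo r)
      (InPass i (t `\ (n, L)) (todo `\ (n, L)) true)
| StepAgain i t :
    step G S k strat (InPass i t set0 true) (PassStart i t)
| StepStable i t :
    step G S k strat (InPass i t set0 false) (IterEnd i t)
| StepNext i t :
    step G S k strat (IterEnd i t) (LoopHead i.+1 t).

Definition init : state := LoopHead 1 set0.

Definition reachable G S (k : nat) (strat : Lab -> nat) (s : state) : Prop :=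
  clos_refl_trans state (step G S k strat) init s.

End Semantics.

(* Every maximal execution from [s] reaches, after finitely many steps, a state
   satisfying [Q]. *)
Inductive inevitable (T : Type) (R : T -> T -> Prop) (Q : T -> Prop) (s : T) :
    Prop :=
| InevitableNow of Q s
| InevitableStep of (exists s', R s s') &
    (forall s', R s s' -> inevitable R Q s').

Arguments init {IRI Lit Blank Lab}.
Arguments LoopHead {IRI Lit Blank Lab} _ _.
Arguments PassStart {IRI Lit Blank Lab} _ _.
Arguments InPass {IRI Lit Blank Lab} _ _ _ _.
Arguments IterEnd {IRI Lit Blank Lab} _ _.
Arguments Return {IRI Lit Blank Lab} _.

(* Main.v *)
Require Import Defs.
From mathcomp Require Import all_boot all_classical.
From Stdlib Require Import Relation_Operators.

(** The satisfaction of a shape expression is monotone in the typing as long as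
    the typing is unchanged on the labels under a negation; by stratification
    those labels belong to lower strata. Hence the typings between which
    iteration [i] moves, all equal to [typing_(i-1)] on the lower strata, satisfy
    expressions monotonically. Every removed pair therefore lies outside
    [typing_i], and a pass without removal leaves a correct typing, which is
    contained in [typing_i] by maximality. Each repeated pass has strictly shrunk
    a finite typing, so the iteration terminates. *)

Set Implicit Arguments.
Unset Strict Implicit.
Unset Printing Implicit Defensive.

Local Open Scope classical_set_scope.

(** * Induction on finite sets and general facts on transition systems *)

Lemma finite_set_proper_ind (T : Type) (P : set T -> Prop) :
  (forall A, finite_set A -> (forall B, B `<` A -> P B) -> P A) ->
  forall A, finite_set A -> P A.
Proof.
move=> IH A finA.
(* As [T] is an arbitrary type, [{classic T}] supplies the choice structure needed to count elements
   through [fset_set]. *)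
pose card (B : set T) := size (finmap.enum_fset (fset_set (T := {classic T}) B)).
have [n] := ubnP (card A); elim: n A finA => // n IHn A finA lt_An.
apply: IH => // B [sBA nsAB].
have finB : finite_set B by apply: sub_finite_set finA.
apply: IHn => //; move: lt_An; rewrite ltnS; apply: leq_trans.
apply: finmap.fproper_ltn_card; rewrite finmap.fproperE.
by apply/andP; split; [|apply/negP]; rewrite -(@fset_set_sub {classic T}).
Qed.

Lemma setD1_proper (T : Type) (A : set T) x : A x -> A `\ x `<` A.
Proof.
by move=> Ax; split=> [y []//|/(_ x Ax)[_]]; apply.
Qed.

Lemma inevitable_trans (T : Type) (R : T -> T -> Prop) (P Q : T -> Prop) s :
  inevitable R P s -> (forall s', P s' -> inevitable R Q s') ->
  inevitable R Q s.
Proof.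
move=> evP PQ; elim: evP => {}s; first exact: PQ.
by move=> exR _ IH; apply: InevitableStep.
Qed.

Lemma clos_refl_trans_invariant (T : Type) (R : T -> T -> Prop) (I : T -> Prop) :
  (forall s s', R s s' -> I s -> I s') ->
  forall s s', clos_refl_trans T R s s' -> I s -> I s'.
Proof.
by move=> RI s s'; elim=> [s1 s2 /RI//|//|s1 s2 s3 _ I12 _ I23 /I12 /I23].
Qed.

(** * Monotonicity of satisfaction in the typing *)

Section Satisfaction.
Variables IRI Lit Blank Lab : Type.
Implicit Types (N G : set (triple IRI Lit Blank)).
Implicit Types (t : set (term IRI Lit Blank * Lab)).

(** Triple expressions contain no negation and consult the typing only at arcs, so the same
    decomposition of [N] serves for both typings. *)
Lemma sat_texpr_mono t t' N (E : texpr IRI Lab) :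
  (forall n L, in_texpr L E -> t (n, L) -> t' (n, L)) ->
  sat_texpr t N E -> sat_texpr t' N E.
Proof.
elim: E N => [P L||E1 IH1 E2 IH2|E1 IH1 E2 IH2|E1 IH1 a b] N /= tt' //.
- by case=> s [p [o [-> Pp /tt' t'oL]]]; exists s, p, o; split=> //; apply: t'oL.
- by case=> [/IH1|/IH2] sat; [left|right]; apply: sat => n L EL;
    apply: tt'; [left|right].
- case=> N1 [N2 [-> dis /IH1 sat1 /IH2 sat2]]; exists N1, N2; split=> //.
  + by apply: sat1 => n L EL; apply: tt'; left.
  + by apply: sat2 => n L EL; apply: tt'; right.
- case=> k [F [ak kb -> triv sat]]; exists k, F; split=> // j.
  exact: IH1 (sat j).
Qed.

Lemma sat_sexpr_eq G t t' n (S : sexpr IRI Lit Lab) :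
  (forall m L, in_sexpr L S -> t (m, L) <-> t' (m, L)) ->
  sat_sexpr G t n S <-> sat_sexpr G t' n S.
Proof.
elim: S => [V|E|S1 IH1 S2 IH2|S1 IH1 S2 IH2|S1 IH1] /= tt' //.
- by split; apply: sat_texpr_mono => m L /(tt' m)[].
- have {}IH1 := IH1 (fun m L SL => tt' m L (or_introl SL)).
  have {}IH2 := IH2 (fun m L SL => tt' m L (or_intror SL)).
  tauto.
- have {}IH1 := IH1 (fun m L SL => tt' m L (or_introl SL)).
  have {}IH2 := IH2 (fun m L SL => tt' m L (or_intror SL)).
  tauto.
- by have {}IH1 := IH1 tt'; tauto.
Qed.

(** Only negation could break monotonicity; there every label of the body counts as negated, so both
    typings agree on the body and [sat_sexpr_eq] applies. *)
Lemma sat_sexpr_mono G t t' n (S : sexpr IRI Lit Lab) :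
  (forall m L, in_sexpr L S -> t (m, L) -> t' (m, L)) ->
  (forall m L, under_not L S -> t (m, L) <-> t' (m, L)) ->
  sat_sexpr G t n S -> sat_sexpr G t' n S.
Proof.
elim: S => [V|E|S1 IH1 S2 IH2|S1 IH1 S2 IH2|S1 IH1] /= tt' eqtt' //.
- exact: sat_texpr_mono.
- by case=> [/IH1 sat1 /IH2 sat2]; split; [apply: sat1|apply: sat2] => m L SL;
    (apply: tt' || apply: eqtt'); by [left|right].
- by case=> [/IH1|/IH2] sat; [left|right]; apply: sat => m L SL;
    (apply: tt' || apply: eqtt'); by [left|right].
- by move=> nsat sat; apply: nsat; apply/(sat_sexpr_eq _ _ eqtt').
Qed.

Lemma finite_Nodes G : finite_set G -> finite_set (Nodes G).
Proof.
move=> finG.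
apply: (@sub_finite_set _ _ (@triple_subj _ _ _ @` G `|` @triple_obj _ _ _ @` G)).
  by move=> n [x Gx [->|->]]; [left|right]; exists x.
by rewrite finite_setU; split; apply: finite_image.
Qed.

End Satisfaction.

(** * Strata and the typings [typing_i] *)

Section Stratified.
Variables (IRI Lit Blank Lab : Type) (G : set (triple IRI Lit Blank)).
Variables (S : schema IRI Lit Lab) (k : nat) (strat : Lab -> nat).
Hypotheses (wfS : wf_schema S) (stratS : stratification S k strat).
Implicit Types (t todo : set (term IRI Lit Blank * Lab)).

Local Notation typing_ := (strata_typing G S strat).
Local Notation labels_ := (labels_upto S strat).
Local Notation schema_ := (schema_upto S strat).

Lemma in_def_labels_upto i L L' :
  labels_ i L -> in_sexpr L' (def S L) -> labels_ i L'.
Proof.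
case: stratS => _ _ negS posS [SL Li] L'L; have SL' := wfS SL L'L.
split=> //; apply: leq_trans Li.
have [neg|nneg] := EM (under_not L' (def S L)).
  by apply/ltnW/negS.
exact: posS.
Qed.

(** The strict inequality imposed by [dep_neg] is what gains one stratum here. *)
Lemma under_not_def_labels_upto i L L' :
  labels_ i.+1 L -> under_not L' (def S L) -> labels_ i L'.
Proof.
case: stratS => _ _ negS _ [SL Li] L'L.
have SL' : labels S L'.
  (* By induction on the expression, a label under a negation occurs in the expression. *)
  apply: (wfS SL); elim: (def S L) L'L => //= S1 IH1 S2 IH2;
  by case=> [/IH1|/IH2]; tauto.
by split=> //; rewrite -ltnS; apply: leq_trans Li; apply: negS.
Qed.

Lemma labels_upto_le i j : i <= j -> labels_ i `<=` labels_ j.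
Proof. by move=> ij L [SL Li]; split=> //; apply: leq_trans ij. Qed.

Lemma labels_uptoS i L : labels_ i.+1 L -> labels_ i L \/ strat L = i.+1.
Proof.
case=> SL; rewrite leq_eqVlt => /orP[/eqP|] Li; first by right.
by left.
Qed.

Lemma restrict_typing_agree t t' i n L :
  restrict_typing t (labels_ i) = restrict_typing t' (labels_ i) ->
  labels_ i L -> t (n, L) <-> t' (n, L).
Proof.
move=> /predeqP/(_ (n, L)); rewrite /restrict_typing /= => tt' iL.
by split=> tnL; apply tt'.
Qed.

Lemma sat_def_mono t t' i n L :
  labels_ i.+1 L ->
  restrict_typing t (labels_ i) = restrict_typing t' (labels_ i) ->
  t `<=` t' -> sat_sexpr G t n (def S L) -> sat_sexpr G t' n (def S L).
Proof.
move=> iL tt'i tt'; apply: sat_sexpr_mono => m L'; first by move=> _; apply: tt'.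
move=> /(under_not_def_labels_upto iL); exact: restrict_typing_agree.
Qed.

Lemma sat_def_eq t t' i n L :
  labels_ i L ->
  restrict_typing t (labels_ i) = restrict_typing t' (labels_ i) ->
  sat_sexpr G t n (def S L) <-> sat_sexpr G t' n (def S L).
Proof.
move=> iL tt'i; apply: sat_sexpr_eq => m L' /(in_def_labels_upto iL).
exact: restrict_typing_agree.
Qed.

Lemma labels_upto0 L : ~ labels_ 0 L.
Proof.
by case: stratS => _ bnd _ _ [/bnd/andP[L1 _]]; rewrite leqNgt L1.
Qed.

(** Stratum 0 is empty and the dummy [typing_0] is [set0], so the constraint on the restriction is
    vacuous for [i = 0] and the first stratum needs no separate treatment. *)
Lemma strata_typingS i :
  typing_ i.+1 =
  \bigcup_(t in [set t | correct_typing G (schema_ i.+1) t /\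
                         restrict_typing t (labels_ i) = typing_ i]) t.
Proof.
case: i => //=; congr bigcup; apply/predeqP => t /=; split=> [corr|[]//].
by split=> //; apply/predeqP => x; split=> // -[_ /labels_upto0].
Qed.

Lemma restrict_typing_id t i :
  is_typing G (schema_ i) t -> restrict_typing t (labels_ i) = t.
Proof. by move=> typ; apply/predeqP => x; split=> [[]//|tx]; have [] := typ _ tx. Qed.

(** The two claims need each other: each competitor [t] in the union agrees with the union on lower
    strata by the second claim, so satisfaction passes from [t] to the union; correctness in turn
    gives the second claim one stratum higher. *)
Lemma strata_typing_correct i :
  correct_typing G (schema_ i) (typing_ i) /\
  restrict_typing (typing_ i.+1) (labels_ i) = typing_ i.
Proof.
elim: i => [|i [corr restr]].
  by split=> //; apply/predeqP => x; split=> // -[_ /labels_upto0].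
have corrS : correct_typing G (schema_ i.+1) (typing_ i.+1).
  split.
    by rewrite strata_typingS => x [t [[typ _] _]] /typ.
  move=> n L; rewrite {1}strata_typingS => -[t [corrt restrt] tnL].
  have [typt satt] := corrt; apply: (@sat_def_mono t _ i); last exact: satt.
  - by have [] := typt _ tnL.
  - by rewrite restrt.
  - by rewrite strata_typingS => x tx; exists t.
split=> //; apply/predeqP => x; rewrite [typing_ i.+2]strata_typingS; split.
  by case=> -[t [_ <-] tx].
move=> tx; have [typS satS] := corrS; have [Nx Lx] := typS _ tx.
(* [typing_ i.+1] is itself a competitor for the next stratum, one that assigns no label of that
   stratum. *)
split=> //; exists (typing_ i.+1) => //; split; last exact: restrict_typing_id.
split=> // y /typS[Ny Ly]; split=> //=; exact: labels_upto_le Ly.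
Qed.

Lemma correct_typing_strata i : correct_typing G (schema_ i) (typing_ i).
Proof. by have [] := strata_typing_correct i. Qed.

Lemma restrict_typing_strataS i :
  restrict_typing (typing_ i.+1) (labels_ i) = typing_ i.
Proof. by have [] := strata_typing_correct i. Qed.

Lemma restrict_typing_strata i :
  restrict_typing (typing_ i) (labels_ i) = typing_ i.
Proof. by apply: restrict_typing_id; have [] := correct_typing_strata i. Qed.

(** * Invariants of the execution; [over_approx i] concerns iteration [i.+1] *)

Definition over_approx i t :=
  [/\ is_typing G (schema_ i.+1) t, restrict_typing t (labels_ i) = typing_ i
    & typing_ i.+1 `<=` t].

Lemma over_approx_init i :
  over_approx i (typing_ i `|`
    [set x | [/\ Nodes G x.1, labels S x.2 & strat x.2 = i.+1]]).
Proof.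
have [typ _] := correct_typing_strata i.
split.
- move=> x [/typ[Nx Lx]|[Nx Lx eqx]]; split=> //=; last by split=> //; rewrite eqx.
  exact: labels_upto_le Lx.
- apply/predeqP => x; split=> [[[//|[_ _ eqx]] [_]]|tx].
    by rewrite eqx ltnn.
  by have [_ Lx] := typ _ tx; split=> //; left.
- have [typS _] := correct_typing_strata i.+1.
  move=> x tx; have [Nx Lx] := typS _ tx.
  have [iL|eqx] := labels_uptoS Lx; [left|by right; split=> //; case: Lx].
  by rewrite -restrict_typing_strataS.
Qed.

(** Were [(n, L)] in [typing_ i.+1], its definition would hold there, hence by monotonicity also in
    the larger [t], against [nsat]. *)
Lemma over_approx_remove i t n L :
  over_approx i t -> t (n, L) -> strat L = i.+1 ->
  ~ sat_sexpr G t n (def S L) -> over_approx i (t `\ (n, L)).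
Proof.
move=> [typ restr sub] tnL eqL nsat; split.
- by move=> x [/typ].
- rewrite -restr; apply/predeqP => x; split=> [[[tx _] Lx]//|[tx Lx]].
  by split=> //; split=> // eqx; move: Lx; rewrite eqx => -[_]; rewrite /= eqL ltnn.
- move=> x Tx; split=> [|eqx]; first exact: sub.
  apply: nsat; have [_ satT] := correct_typing_strata i.+1.
  apply: (@sat_def_mono (typing_ i.+1) _ i) => //.
  + by have [] := typ _ tnL.
  + by rewrite restrict_typing_strataS.
  + by apply: satT; rewrite -[(n, L)]eqx.
Qed.

(** Such a [t] is a correct typing, hence one of the competitors in the union: pairs of stratum
    [i.+1] are satisfied by assumption, and those below because their definitions mention only
    labels on which [t] agrees with [typing_ i]. *)
Lemma over_approx_stable i t :
  over_approx i t ->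
  (forall n L, t (n, L) -> strat L = i.+1 -> sat_sexpr G t n (def S L)) ->
  t = typing_ i.+1.
Proof.
move=> [typ restr sub] sat; apply/seteqP; split=> //.
rewrite strata_typingS => x tx; exists t => //; split=> //; split=> // n L tnL.
have [_ Lx] := typ _ tnL.
have [iL|eqL] := labels_uptoS Lx; last exact: sat.
have [_ satT] := correct_typing_strata i.
apply/(sat_def_eq (t' := typing_ i) n iL); first by rewrite restr restrict_typing_strata.
by apply: satT; rewrite -restr.
Qed.

(** The last clause of [InPass] is claimed only while the pass has removed nothing: a removal may
    invalidate pairs already visited and kept. *)
Definition invariant (s : state IRI Lit Blank Lab) : Prop :=
  match s with
  | LoopHead i t => [/\ 0 < i, i <= k.+1 & t = typing_ i.-1]
  | PassStart i t => 0 < i <= k /\ over_approx i.-1 t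
  | InPass i t todo r =>
      [/\ 0 < i <= k, over_approx i.-1 t,
          todo `<=` [set x | t x /\ strat x.2 = i]
        & r = false -> forall n L, t (n, L) -> strat L = i ->
            ~ todo (n, L) -> sat_sexpr G t n (def S L)]
  | IterEnd i t => 0 < i <= k /\ t = typing_ i
  | Return t => t = typing_ k
  end.

Lemma step_invariant s s' :
  step G S k strat s s' -> invariant s -> invariant s'.
Proof.
case=> {s s'} /=.
- by case=> [t _ []|i t ik [_ _ ->]] //; split=> //; apply: over_approx_init.
- move=> i t ki [_ ik ->]; congr typing_.
  by have -> : i = k.+1 by apply/eqP; rewrite eqn_leq ik.
- by move=> i t [ik app]; split=> // _ n L tnL eqL [].
- move=> i t todo r n L tdL sat [ik app sub rest]; split=> //.
    by move=> x [/sub].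
  (* A pair no longer pending either was so before this step or is the one just kept. *)
  move=> /rest{}rest m L' tmL' eqL' ntd.
  have [tdL'|] := EM (todo (m, L')); last exact: rest.
  have [[-> ->]//|ne] := EM ((m, L') = (n, L)).
  by case: ntd.
- case=> [t todo r n L _ _ []|i t todo r n L tdL nsat [ik app sub _]] //.
  have [tnL eqL] := sub _ tdL; split=> //.
    exact: over_approx_remove.
  by move=> x [/sub[tx eqx] ne].
- by move=> i t [].
- case=> [t []|i t [ik app _ /(_ erefl) sat]] //; split=> //.
  by apply: over_approx_stable => // n L tnL eqL; apply: sat.
- by move=> i t [/andP[_ ik] ->].
Qed.

Lemma reachable_invariant s : reachable G S k strat s -> invariant s.
Proof.
move=> /(clos_refl_trans_invariant step_invariant); apply.
by split.
Qed.

(** * Termination *)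

Hypotheses (finG : finite_set G) (finS : finite_set (labels S)).

Lemma over_approx_finite i t : over_approx i t -> finite_set t.
Proof.
case=> typ _ _; apply: (@sub_finite_set _ _ (Nodes G `*` labels S)).
  by move=> x /typ[Nx []].
by apply: finite_setX => //; apply: finite_Nodes.
Qed.

(** Two nested inductions on finite sets: the outer one on the typing at the start of a pass, the
    inner one on the pairs still to be visited. *)
Lemma inevitable_IterEnd i t :
  invariant (PassStart i t) ->
  inevitable (step G S k strat) (fun s => s = IterEnd i (typing_ i))
    (PassStart i t).
Proof.
move=> inv; have fint : finite_set t by case: inv => _ /over_approx_finite.
elim/finite_set_proper_ind: t / fint inv => t fint IHt inv.
apply: InevitableStep; first by eexists; apply: StepPass.
move=> s' stepp; have := step_invariant stepp inv.
inversion stepp as [| |? ?| | | | |]; subst => {stepp}.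
(* The flag [r] witnesses a strict decrease of the typing since the start of the pass, which is what
   the outer hypothesis requires when another pass begins. *)
suff pass_ends todo : finite_set todo -> forall t' (r : bool), t' `<=` t ->
    (r -> t' `<` t) -> invariant (InPass i t' todo r) ->
    inevitable (step G S k strat) (fun s => s = IterEnd i (typing_ i))
      (InPass i t' todo r).
  by apply: pass_ends => //; apply: sub_finite_set fint => x [].
move=> fintd; elim/finite_set_proper_ind: todo / fintd => todo _ IHtd t' r sub prop inv'.
apply: InevitableStep.
  (* The execution is never stuck inside a pass: a pending pair is kept or removed, and with none
     left [r] selects the step. *)
  have [[[n L] tdL]|/nonemptyPn ->] := EM (todo !=set0).
    have [sat|nsat] := EM (sat_sexpr G t' n (def S L)).
      by eexists; apply: StepKeep tdL sat.
    by eexists; apply: StepRemove tdL nsat.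
  by case: (r); eexists; (exact: StepAgain || exact: StepStable).
move=> s' stepp; have invs' := step_invariant stepp inv'.
inversion stepp as [| | |? ? ? ? n L tdL sat|? ? ? ? n L tdL nsat|? ?|? ?|];
  subst => {stepp}.
- by apply: IHtd => //; apply: setD1_proper.
- have t'nL : t' (n, L) by case: inv' => _ _ /(_ _ tdL)[].
  have t'pr := setD1_proper t'nL.
  apply: IHtd => //; first exact: setD1_proper.
    by move=> x [/sub].
  move=> _; split=> [x [/sub]//|sub'].
  by have [_] := sub' _ (sub _ t'nL); apply.
- by apply: IHt => //; apply: prop.
- by apply: InevitableNow; case: invs' => _ ->.
Qed.

Lemma inevitable_iteration i :
  0 < i <= k ->
  inevitable (step G S k strat) (fun s => s = IterEnd i (typing_ i))
    (LoopHead i (typing_ i.-1)).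
Proof.
move=> /andP[i0 ik]; have inv : invariant (LoopHead i (typing_ i.-1)).
  by split=> //; apply: leqW.
apply: InevitableStep; first by eexists; apply: StepEnter.
move=> s' stepp; have inv' := step_invariant stepp inv.
inversion stepp as [|? ? ki| | | | | |]; subst => {stepp}.
  exact: inevitable_IterEnd.
by move: ki; rewrite ltnNge ik.
Qed.

Lemma inevitable_next i :
  inevitable (step G S k strat) (fun s => s = LoopHead i.+1 (typing_ i))
    (IterEnd i (typing_ i)).
Proof.
apply: InevitableStep; first by eexists; apply: StepNext.
by move=> s' stepp; inversion stepp; subst; apply: InevitableNow.
Qed.

(** The induction starts at [i = 0] because [init] is [LoopHead 1 set0] and the dummy [typing_0] is
    [set0]. *)
Lemma inevitable_LoopHead i :
  i <= k ->
  inevitable (step G S k strat) (fun s => s = LoopHead i.+1 (typing_ i)) init.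
Proof.
elim: i => [|i IH] ik; first exact: InevitableNow.
apply: inevitable_trans (IH (ltnW ik)) _ => _ ->.
apply: inevitable_trans (inevitable_iteration _) _; first exact: ik.
by move=> _ ->; apply: inevitable_next.
Qed.

Lemma inevitable_Return :
  inevitable (step G S k strat) (fun s => s = Return (typing_ k)) init.
Proof.
apply: inevitable_trans (inevitable_LoopHead (leqnn k)) _ => _ ->.
apply: InevitableStep; first by eexists; apply: StepExit.
move=> s' stepp; inversion stepp as [? ? kk| | | | | | |]; subst.
  by move: kk; rewrite ltnn.
exact: InevitableNow.
Qed.

End Stratified.

Theorem mainTheorem4 (IRI Lit Blank Lab : Type)
    (G : set (triple IRI Lit Blank)) (S : schema IRI Lit Lab)
    (k : nat) (strat : Lab -> nat)
    (finG : finite_set G) (finS : finite_set (labels S))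
    (wfS : wf_schema S) (dnfS : dnf_schema S)
    (stratS : stratification S k strat) :
  (inevitable (step G S k strat)
      (fun s => s = Return (Typing G S k strat)) init
   /\ (forall t, reachable G S k strat (Return t) -> t = Typing G S k strat))
  /\
  (forall i, 1 <= i <= k ->
     inevitable (step G S k strat)
       (fun s => s = IterEnd i (strata_typing G S strat i)) init
     /\ (forall t, reachable G S k strat (IterEnd i t) ->
           t = strata_typing G S strat i)).
Proof.
split; first split.
- exact: inevitable_Return.
- by move=> t /(reachable_invariant wfS stratS).
- move=> i ik; split; last by move=> t /(reachable_invariant wfS stratS)[].
  case: i ik => // i ik.
  apply: inevitable_trans (inevitable_LoopHead wfS stratS finG finS (ltnW ik)) _.
  by move=> _ ->; apply: (inevitable_iteration wfS stratS finG finS).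
Qed.
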